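(* Let $R$ be a PVMD and $P$ a $t$-prime ideal of $R$. Then: (1) $T(P)\subsetneq\Omega(P)$ if and only if $T(P)=R_P\cap\Omega(P)$ and $\Omega(P)\nsubseteq R_P$. (2) The following conditions are equivalent: (i) $(P\Omega(P))_{t_1}=\Omega(P)$, where $t_1$ denotes the $t$-operation with respect to $\Omega(P)$; (ii) $\Omega(P)\nsubseteq R_P$; (iii) $P=\sqrt{I}$ for some $t$-invertible ideal $I$ of $R$.
   Context: Let $R$ be an integral domain with quotient field $K$. For nonzero fractional ideals $I,J$ of $R$, $(I:J)=\{x\in K : xJ\subseteq I\}$ and $I^{-1}=(R:I)$. The $v$-closure is $I_v=(I^{-1})^{-1}$ and the $t$-closure is $I_t=\bigcup J_v$, where $J$ ranges over the nonzero finitely generated subideals of $I$; the $t$-operation with respect to another domain with quotient field $K$ is defined in the same way with that domain in place of $R$. A $t$-ideal of $R$ is a nonzero ideal $I\subseteq R$ with $I=I_t$; a $t$-prime ideal is a prime $t$-ideal. A fractional ideal $I$ is $t$-invertible if $(II^{-1})_t=R$. $R$ is a PVMD (Prüfer $v$-multiplication domain) if every nonzero finitely generated ideal of $R$ is $t$-invertible. For a nonzero ideal $I$ of $R$, the Nagata transform is $T(I)=\bigcup_{n\ge 1}(R:I^n)$ and the Kaplansky transform is $\Omega(I)=\{u\in K : \text{for every } a\in I \text{ there is a positive integer } n(a) \text{ with } ua^{n(a)}\in R\}$; both are rings between $R$ and $K$, and $T(I)\subseteq\Omega(I)$. *)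

(* Defs.v *)
(* An integral domain with quotient field K is represented as a subring
   D : set K such that every element of K is a quotient of elements of D.
   All ideal operations take the base domain D as a parameter, since they are
   also used over overrings of the base domain. *)
From HB Require Import structures.
From mathcomp Require Import all_boot all_order all_algebra.
From mathcomp Require Import boolp classical_sets.

Set Implicit Arguments.
Unset Strict Implicit.
Unset Printing Implicit Defensive.

Import GRing.Theory.

Local Open Scope classical_set_scope.
Local Open Scope ring_scope.

Section Ideals.
Variable K : fieldType.
Implicit Types D I J P : set K.

Definition domain_with_quotient_field D : Prop :=
  subring_closed [in D] /\
  forall x : K, exists a b : K, [/\ D a, D b, b != 0 & x = a / b].

Definition submodule D I : Prop :=
  [/\ I 0, (forall x y, I x -> I y -> I (x + y))
    & (forall d x, D d -> I x -> I (d * x))].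

Definition ideal D I : Prop := submodule D I /\ I `<=` D.

Definition nonzero I : Prop := exists2 x, I x & x != 0.

Definition prime_ideal D P : Prop :=
  [/\ ideal D P, ~ P 1
    & (forall a b, D a -> D b -> P (a * b) -> P a \/ P b)].

Definition span D n (g : 'I_n -> K) : set K :=
  [set x | exists2 c : 'I_n -> K,
             (forall i, D (c i)) & x = \sum_(i < n) c i * g i].

Definition finitely_generated D I : Prop :=
  exists (n : nat) (g : 'I_n -> K), I = span D g.

Definition ideal_mul I J : set K :=
  [set x | exists (n : nat) (a b : 'I_n -> K),
             [/\ (forall i, I (a i)), (forall i, J (b i))
               & x = \sum_(i < n) a i * b i]].

(* I^1 is I itself, and I^0 is D. *)
Definition ideal_exp D I (n : nat) : set K := iterop n ideal_mul I D.

Definition colon I J : set K := [set x | forall y, J y -> I (x * y)].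

Definition ideal_inv D I : set K := colon D I.

Definition v_closure D I : set K := ideal_inv D (ideal_inv D I).

Definition t_closure D I : set K :=
  \bigcup_(J in [set J | [/\ finitely_generated D J, nonzero J & J `<=` I]])
    v_closure D J.

Definition t_ideal D I : Prop :=
  [/\ ideal D I, nonzero I & I = t_closure D I].

Definition t_prime_ideal D P : Prop := prime_ideal D P /\ t_ideal D P.

Definition t_invertible D I : Prop :=
  t_closure D (ideal_mul I (ideal_inv D I)) = D.

Definition PVMD D : Prop :=
  domain_with_quotient_field D /\
  forall I, ideal D I -> nonzero I -> finitely_generated D I ->
    t_invertible D I.

Definition nagata D I : set K :=
  \bigcup_(n in [set n : nat | (0 < n)%N]) colon D (ideal_exp D I n).

Definition kaplansky D I : set K :=
  [set u | forall a, I a -> exists2 n : nat, (0 < n)%N & D (u * a ^+ n)].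

Definition localization D P : set K :=
  [set x | exists a s : K, [/\ D a, D s, ~ P s & x = a / s]].

Definition radical D I : set K :=
  [set x | D x /\ exists2 n : nat, (0 < n)%N & I (x ^+ n)].

End Ideals.

(* Main.v *)
Require Import Defs.
From HB Require Import structures.
From mathcomp Require Import all_boot all_order all_algebra.
From mathcomp Require Import boolp classical_sets.
From mathcomp Require Import ring.

Set Implicit Arguments.
Unset Strict Implicit.
Unset Printing Implicit Defensive.

Import GRing.Theory.

Local Open Scope classical_set_scope.
Local Open Scope ring_scope.

(** Write O for the Kaplansky transform of P and T for its Nagata transform.

    Everything is done with elements, without valuation overrings. A
    t-invertible ideal I supplies finitely many a_t in I and b_t in the inverse
    of I such that an element of K multiplying all the products a_t b_t into R
    lies in R itself: [gv_of_t_closure] unwinds the equality of the t-closure of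
    I I^-1 with R in this way. The engine is [gv_absorb]: if y multiplies a high
    power of each a_t into R, then y multiplies a high power of the whole ideal
    I into R. It replaces the usual verification at every t-maximal ideal.

    In a PVMD the ideal of denominators (R : R + R u) of any u in K is
    t-invertible, being the inverse of a finitely generated fractional ideal.
    When u is outside R_P this ideal lies in P.

    - If u is in O but not in R_P, every element of P has a power among the
      denominators of u, so P is the radical of this t-invertible ideal
      ([radical_of_kaplansky]).
    - If P is the radical of a t-invertible I, the a_t generate over O an ideal
      with inverse O, so P O has t-closure O ([t_closure_of_radical]).
    - If P O has t-closure O, then O contains the inverse of a finitely
      generated A inside P. If moreover O were inside R_P, then A A^-1 would lie
      in P, contradicting the t-invertibility of A since P is a t-ideal
      ([kaplansky_nonlocal]).

    These close the cycle of equivalences in the second part. The first part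
    rests on two inclusions. The intersection of O with R_P always lies in
    (R : P), hence in T ([kaplansky_local_inv]). And if T contains some u
    outside R_P, then some P^n consists of denominators of u; an element w of O
    multiplies some power of the generators a_t in P into R, hence by [gv_absorb]
    a power of the ideal of denominators, hence a power of P: so O = T
    ([kaplansky_sub_nagata]). Thus a proper inclusion of T in O forces T inside
    R_P, so T is the intersection of O and R_P, and then O is not inside R_P. *)

(** * Subrings and finite generation *)

Section Subrings.
Variables (K : fieldType) (D : set K).
Hypothesis ringD : subring_closed [in D].

Lemma subring1 : D 1.
Proof. by case: ringD => + _ _; rewrite in_setE. Qed.

Lemma subringB x y : D x -> D y -> D (x - y).
Proof.
case: ringD => _ + _ => cl Dx Dy.
by have := cl x y; rewrite !in_setE => /(_ Dx Dy).
Qed.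

Lemma subringM x y : D x -> D y -> D (x * y).
Proof.
case: ringD => _ _ cl Dx Dy.
by have := cl x y; rewrite !in_setE => /(_ Dx Dy).
Qed.

Lemma subring0 : D 0.
Proof. by rewrite -(subrr 1); apply: subringB; exact: subring1. Qed.

Lemma subringD x y : D x -> D y -> D (x + y).
Proof.
move=> Dx Dy; rewrite -(opprK y) -(add0r (- y)).
by apply: subringB => //; apply: subringB => //; exact: subring0.
Qed.

Lemma subringX x n : D x -> D (x ^+ n).
Proof.
move=> Dx; elim: n => [|n IHn]; first by rewrite expr0; exact: subring1.
by rewrite exprS; exact: subringM.
Qed.

Lemma subring_sum (T : finType) (F : T -> K) :
  (forall t, D (F t)) -> D (\sum_t F t).
Proof.
by move=> DF; apply: big_ind => //; [exact: subring0|exact: subringD].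
Qed.

Lemma span_gen n (g : 'I_n -> K) i : Defs.span D g (g i).
Proof.
exists (fun j => (j == i)%:R) => [j|].
  by case: (j == i); [exact: subring1|exact: subring0].
rewrite (bigD1 i) //= eqxx mul1r big1 ?addr0 // => j /negbTE ->.
by rewrite mul0r.
Qed.

Lemma colon_span n (g : 'I_n -> K) y :
  (forall i, D (y * g i)) -> colon D (Defs.span D g) y.
Proof.
move=> Dyg _ [c Dc ->]; rewrite mulr_sumr.
by apply: subring_sum => i; rewrite mulrCA; exact: subringM.
Qed.

Lemma span_ideal n (g : 'I_n -> K) :
  (forall i, D (g i)) -> ideal D (Defs.span D g).
Proof.
move=> Dg; split; first split.
- exists (fun=> 0) => [_|]; first exact: subring0.
  by rewrite big1 // => i _; rewrite mul0r.
- move=> _ _ [c Dc ->] [d Dd ->]; exists (fun i => c i + d i) => [i|].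
    exact: subringD.
  by rewrite -big_split; apply: eq_bigr => i _; rewrite mulrDl.
- move=> d _ Dd [c Dc ->]; exists (fun i => d * c i) => [i|].
    exact: subringM.
  by rewrite mulr_sumr; apply: eq_bigr => i _; rewrite mulrA.
- by move=> _ [c Dc ->]; apply: subring_sum => i; exact: subringM.
Qed.

Lemma t_closure_sub (J : set K) : J `<=` D -> t_closure D J `<=` D.
Proof.
move=> JD x [F [_ _ FJ] Fvx]; rewrite -(mulr1 x); apply: Fvx => y Fy.
by rewrite mul1r; apply/JD/FJ.
Qed.

Lemma t_closureS (I J : set K) : I `<=` J -> t_closure D I `<=` t_closure D J.
Proof.
by move=> IJ x [F [Ffg F0 FI] Fvx]; exists F => //; split=> // y /FI/IJ.
Qed.

End Subrings.

(** * Glaz-Vasconcelos families and powers *)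

Section GlazVasconcelos.
Variables (K : fieldType) (D : set K).
Hypothesis ringD : subring_closed [in D].

(** For S = D and g in D this says that the g_t generate a Glaz-Vasconcelos
    ideal, one whose inverse is D. The target S is a parameter because the
    property passes from D to the sets (D : I^n). *)
Definition gv_family (S : set K) (T : finType) (g : T -> K) : Prop :=
  forall y, (forall t, S (y * g t)) -> S y.

(** A finitely generated F inside I J whose v-closure contains 1 has
    (D : F) inside D. Each generator of F is a finite sum of
    products, and the factors of all these sums together form the family. Some
    product is nonzero because F is; this keeps the ideals spanned by the a_t
    nonzero later on. *)
Lemma gv_of_t_closure (I J : set K) : t_closure D (ideal_mul I J) 1 ->
  exists (T : finType) (a b : T -> K),
    [/\ forall t, I (a t), forall t, J (b t),
        (exists t, a t * b t != 0) & gv_family D (fun t => a t * b t)].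
Proof.
case=> F [[n [g ->]] [x gx x0] FIJ] Fv1.
have [m gE] := choice (fun i => FIJ _ (span_gen ringD g i)).
have [a {}gE] := fin_all_exists gE; have [b {}gE] := fin_all_exists gE.
exists {i : 'I_n & 'I_(m i)}, (fun t => a (tag t) (tagged t)),
  (fun t => b (tag t) (tagged t)).
have gD y : (forall t : {i : 'I_n & 'I_(m i)},
    D (y * (a (tag t) (tagged t) * b (tag t) (tagged t)))) ->
    forall i, D (y * g i).
  move=> Dy i; have [_ _ ->] := gE i; rewrite mulr_sumr.
  by apply: subring_sum => // j; exact: (Dy (Tagged (fun i => 'I_(m i)) j)).
split=> [[i j]|[i j]||y Dy] /=; try by have [] := gE i.
- apply: contrapT => ab0; case/eqP: x0; case: gx => c _ ->.
  rewrite big1 // => i _; have [_ _ ->] := gE i; rewrite big1 ?mulr0 // => j _.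
  apply/eqP/negP => /negP abij; apply: ab0.
  by exists (Tagged (fun i => 'I_(m i)) j).
- rewrite -(mul1r y); apply: Fv1; apply: colon_span => //.
  exact: gD.
Qed.

(** The colon (S : I^n), as the iterated colon (... ((S : I) : I) ... : I), so
    that inductions multiply by one element of I at a time. *)
Definition colon_pow (S I : set K) n : set K := iter n (fun L => colon L I) S.

Lemma colon_powD (S I : set K) m n :
  colon_pow S I (m + n) = colon_pow (colon_pow S I n) I m.
Proof. exact: iterD. Qed.

Lemma colon_pow_exp (I : set K) n : (0 < n)%N ->
  colon D (ideal_exp D I n) = colon_pow D I n.
Proof.
case: n => // n _; elim: n => [|n IHn] //; apply/seteqP; split=> u.
  move=> uI x Ix; change (colon_pow D I n.+1 (u * x)); rewrite -IHn => y Iy.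
  rewrite -mulrA; apply: uI; exists 1%N, (fun=> x), (fun=> y); split=> //.
  by rewrite big_ord1.
move=> uI _ [k [a [b [Ia Ib ->]]]]; rewrite mulr_sumr.
apply: subring_sum => // i; rewrite mulrA.
have : colon_pow D I n.+1 (u * a i) := uI _ (Ia i).
by rewrite -IHn => /(_ _ (Ib i)).
Qed.

Lemma colon_pow_elt (I : set K) n u a :
  colon_pow D I n u -> I a -> D (u * a ^+ n).
Proof.
elim: n u => [|n IHn] u Iu Ia; first by rewrite expr0 mulr1.
by rewrite exprS mulrA; apply: IHn => //; exact: Iu.
Qed.

Lemma colon_pow_mono (S S' I : set K) (v w : K) n :
  (forall r, S r -> S' (w * r)) -> colon_pow S I n v ->
  colon_pow S' I n (w * v).
Proof.
move=> SS'; elim: n v => [|n IHn] v; first exact: SS'.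
by move=> Iv x Ix; rewrite -mulrA; apply: IHn; exact: Iv.
Qed.

(** Membership of 1 in (I : P^n) is the inclusion of P^n in I, which gives that
    of P^(n N) in I^N. *)
Lemma colon_pow_comp (I P : set K) n N w :
  colon_pow I P n 1 -> colon_pow D I N w -> colon_pow D P (n * N) w.
Proof.
move=> PI; elim: N w => [|N IHN] w; first by rewrite muln0.
move=> Iw; rewrite mulnS colon_powD -(mulr1 w).
by apply: colon_pow_mono PI => r Ir; apply: IHN; exact: Iw.
Qed.

Lemma colon_powM (I : set K) n d y :
  D d -> colon_pow D I n y -> colon_pow D I n (d * y).
Proof. by move=> Dd; apply: colon_pow_mono => r; exact: subringM. Qed.

Lemma sub_colon_pow (I : set K) n y : I `<=` D -> D y -> colon_pow D I n y.
Proof.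
move=> ID; elim: n y => [|n IHn] y Dy //= x Ix.
by apply: IHn; apply: subringM => //; exact: ID.
Qed.

Lemma gv_colon_pow (I : set K) n (T : finType) (g : T -> K) :
  gv_family D g -> gv_family (colon_pow D I n) g.
Proof.
move=> gv; elim: n => [|n IHn] // y Ly x Ix; apply: IHn => t.
by rewrite mulrAC; exact: Ly.
Qed.

(** Induction on N, an upper bound for the sum of the exponents m_t. To see that
    y x multiplies I^N into D, for x in I, it is enough by the
    Glaz-Vasconcelos property to multiply by each a_t b_t; now x b_t is in D,
    and y a_t satisfies the hypothesis with the exponent of t lowered by one. *)
Lemma gv_absorb (I : set K) (T : finType) (a b : T -> K) N :
  I `<=` D -> (forall t, I (a t)) -> (forall t x, I x -> D (x * b t)) ->
  gv_family D (fun t => a t * b t) ->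
  forall (m : T -> nat) y, (\sum_t m t <= N)%N ->
    (forall t, D (y * a t ^+ m t)) -> colon_pow D I N y.
Proof.
move=> ID Ia Ib gv; elim: N => [|N IHN] m y mN Dy.
  apply: gv => t; have := Dy t.
  move: mN; rewrite (bigD1 t) //= leqn0 addn_eq0 => /andP[/eqP -> _].
  by rewrite expr0 mulr1 => Dyy; apply: subringM => //; exact: Ib.
move=> x Ix; apply: (gv_colon_pow gv) => t.
have -> : y * x * (a t * b t) = x * b t * (y * a t) by ring.
apply: colon_powM; first exact: Ib.
(* A zero exponent means that y is already in D. *)
have [mt0|mt_gt0] := posnP (m t).
  apply: sub_colon_pow => //; apply: subringM => //; last exact/ID.
  by have := Dy t; rewrite mt0 expr0 mulr1.
apply: (IHN (fun s => if s == t then (m t).-1 else m s)) => [|s].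
  rewrite (bigD1 t) //= eqxx -ltnS -addSn prednK //.
  rewrite (bigD1 t) //= in mN; congr (_ <= _)%N : mN; congr addn.
  by apply: eq_bigr => s /negbTE ->.
have [->|_] := eqVneq s t; first by rewrite -mulrA -exprS prednK.
by rewrite mulrAC; apply: subringM => //; exact/ID.
Qed.

(** The case I = D, b = 1 of the previous lemma: powers of the generators of a
    Glaz-Vasconcelos ideal again generate one. *)
Lemma gv_powers (T : finType) (g : T -> K) (m : T -> nat) y :
  (forall t, D (g t)) -> gv_family D g ->
  (forall t, D (y * g t ^+ m t)) -> D y.
Proof.
move=> Dg gv Dy; have D1 := subring1 ringD.
have gv1 : gv_family D (fun t => g t * 1).
  by move=> z Dz; apply: gv => t; have := Dz t; rewrite mulr1.
have Dm (t : T) x : D x -> D (x * 1) by rewrite mulr1.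
have := gv_absorb (fun _ => id) Dg Dm gv1 (leqnn (\sum_t m t)) Dy.
by move=> /colon_pow_elt /(_ D1); rewrite expr1n mulr1.
Qed.

End GlazVasconcelos.

(** * Transforms of ideals *)

Section Transforms.
Variables (K : fieldType) (D I : set K).
Hypotheses (ringD : subring_closed [in D]) (ID : I `<=` D).

Lemma sub_kaplansky : D `<=` kaplansky D I.
Proof.
move=> x Dx a /ID Da; exists 1%N => //.
by rewrite expr1; exact: subringM.
Qed.

Lemma kaplansky_subring : subring_closed [in kaplansky D I].
Proof.
split=> [|u v|u v]; rewrite !in_setE.
- apply: sub_kaplansky; exact: subring1.
- move=> Ku Kv a Ia; have [m m_gt0 Du] := Ku a Ia; have [n n_gt0 Dv] := Kv a Ia.
  exists (m + n)%N; first by rewrite addn_gt0 m_gt0.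
  have -> : (u - v) * a ^+ (m + n) = u * a ^+ m * a ^+ n - v * a ^+ n * a ^+ m.
    by rewrite exprD; ring.
  apply: subringB => //; apply: subringM => //; apply: subringX => //;
    exact: ID.
- move=> Ku Kv a Ia; have [m m_gt0 Du] := Ku a Ia; have [n n_gt0 Dv] := Kv a Ia.
  exists (m + n)%N; first by rewrite addn_gt0 m_gt0.
  have -> : u * v * a ^+ (m + n) = u * a ^+ m * (v * a ^+ n).
    by rewrite exprD; ring.
  exact: subringM.
Qed.

Lemma nagata_sub_kaplansky : nagata D I `<=` kaplansky D I.
Proof.
move=> u [n /= n_gt0]; rewrite colon_pow_exp // => Iu a Ia; exists n => //.
exact: colon_pow_elt Iu Ia.
Qed.

(** The two occasions for choosing exponents are a fixed u with varying a and a
    varying u with fixed a. *)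
Lemma kaplansky_exponents (T : Type) (u a : T -> K) :
  (forall t, kaplansky D I (u t)) -> (forall t, I (a t)) ->
  exists m : T -> nat, forall t, D (u t * a t ^+ m t).
Proof.
move=> Ou Ia; have Da t : exists n, D (u t * a t ^+ n).
  by have [n _ Dn] := Ou t _ (Ia t); exists n.
by have [m Dm] := choice Da; exists m.
Qed.

End Transforms.

(** * Ideals of denominators in a PVMD *)

Definition denominators (K : fieldType) (D : set K) (u : K) : set K :=
  [set r | D r /\ D (r * u)].

Section PVMD.
Variables (K : fieldType) (D : set K).
Hypothesis pvmdD : PVMD D.

Let ringD : subring_closed [in D]. Proof. by case: pvmdD => -[]. Qed.

Let pair_gen (s c : K) (i : 'I_2) : K := if i == 0 then s else c.

Lemma t_invertible_span n (g : 'I_n -> K) i :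
  (forall j, D (g j)) -> g i != 0 -> t_invertible D (Defs.span D g).
Proof.
move=> Dg gi0; apply: pvmdD.2; first exact: span_ideal.
  by exists (g i) => //; exact: span_gen.
by exists n, g.
Qed.

(** With u = a / b, the ideal I of denominators of u is b B^-1 for B = (a, b),
    which is t-invertible. The inverse of I contains b^-1 B, so B B^-1 is inside
    I I^-1, and the t-closure of the latter is squeezed between D and D. *)
Lemma t_invertible_denominators u :
  [/\ ideal D (denominators D u), nonzero (denominators D u)
    & t_invertible D (denominators D u)].
Proof.
have [a [b [Da Db b0 uE]]] := pvmdD.1.2 u.
have bu : b * u = a by rewrite uE mulrC divfK.
split.
- split; last by move=> r [].
  split=> [|r r' [Dr Dru] [Dr' Dru']|d r Dd [Dr Dru]].
  + by split; rewrite ?mul0r; exact: subring0.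
  + by split; rewrite ?mulrDl; exact: subringD.
  + by split; rewrite -?mulrA; exact: subringM.
- by exists b => //; split; rewrite ?bu.
- have Dg i : D (pair_gen b a i) by rewrite /pair_gen; case: ifP.
  have := @t_invertible_span 2 (pair_gen b a) 0 Dg.
  rewrite {1}/pair_gen eqxx => /(_ b0) inv.
  apply/seteqP; split.
    apply: t_closure_sub => // _ [n [x [y [Ix Iy ->]]]].
    by apply: subring_sum => // i; rewrite mulrC; exact: Iy.
  rewrite -{1}inv; apply: t_closureS => _ [n [x [y [Bx By ->]]]].
  exists n, (fun i => b * y i), (fun i => x i / b); split=> [i|i|].
  + split; first by rewrite mulrC; exact/By/(@span_gen _ _ ringD _ _ 0).
    rewrite mulrAC bu mulrC.
    exact/By/(@span_gen _ _ ringD _ (pair_gen b a) 1).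
  + move=> r [Dr Dru]; have [c Dc ->] := Bx i.
    rewrite big_ord_recl big_ord1 /pair_gen /= -bu.
    have -> : (c ord0 * b + c (lift ord0 ord0) * (b * u)) / b * r =
              c ord0 * r + c (lift ord0 ord0) * (r * u) by field.
    by apply: subringD => //; exact: subringM.
  + by apply: eq_bigr => i _; field.
Qed.

(** Writing z_t for elements of (s, c)^-1 witnessing the t-invertibility of
    (s, c), the elements s z_t and c z_t together form a Glaz-Vasconcelos
    family: they generate all products of a member of (s, c) with z_t. *)
Lemma gv_pair s c : D s -> D c -> s != 0 ->
  exists (T : finType) (z : T -> K),
    [/\ forall t, D (s * z t), forall t, D (c * z t)
      & forall y, (forall t, D (y * (s * z t))) ->
                  (forall t, D (y * (c * z t))) -> D y].
Proof.
move=> Ds Dc s0.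
have Dg i : D (pair_gen s c i) by rewrite /pair_gen; case: ifP.
have := @t_invertible_span 2 (pair_gen s c) 0 Dg.
rewrite {1}/pair_gen eqxx => /(_ s0) inv.
have := subring1 ringD; rewrite -{1}inv.
move=> /(gv_of_t_closure ringD) [T [a [z [Ba Bz _ gv]]]].
exists T, z; split=> [t|t|y ys yc].
- by rewrite mulrC; exact/Bz/(@span_gen _ _ ringD _ (pair_gen s c) 0).
- by rewrite mulrC; exact/Bz/(@span_gen _ _ ringD _ (pair_gen s c) 1).
- apply: gv => t; have [d Dd ->] := Ba t.
  rewrite big_ord_recl big_ord1 /pair_gen /=.
  have -> : y * ((d ord0 * s + d (lift ord0 ord0) * c) * z t) =
    d ord0 * (y * (s * z t)) + d (lift ord0 ord0) * (y * (c * z t)) by ring.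
  by apply: subringD => //; exact: subringM.
Qed.

(** * The transforms of a t-prime ideal *)

Variable P : set K.
Hypothesis tprimeP : t_prime_ideal D P.

Let PD : P `<=` D. Proof. by case: tprimeP => -[[]]. Qed.

Let P1 : ~ P 1. Proof. by case: tprimeP => -[]. Qed.

Let PM d x : D d -> P x -> P (d * x).
Proof. by case: tprimeP => -[[[_ _ +] _] _ _] _; apply. Qed.

Let P0 : P 0. Proof. by case: tprimeP => -[[[]]]. Qed.

Let Pprime a b : D a -> D b -> P (a * b) -> P a \/ P b.
Proof. by case: tprimeP => -[_ _ +] _; apply. Qed.

Let PX a n : D a -> P (a ^+ n) -> P a.
Proof.
move=> Da; elim: n => [|n IHn]; first by rewrite expr0 => /P1.
by rewrite exprS => /Pprime [] //; exact: subringX.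
Qed.

Let ringO : subring_closed [in kaplansky D P].
Proof. exact: kaplansky_subring. Qed.

Lemma denominators_sub u :
  ~ localization D P u -> denominators D u `<=` P.
Proof.
move=> locu r [Dr Dru]; apply: contrapT => Pr; apply: locu.
have r0 : r != 0 by apply/eqP => r0; apply: Pr; rewrite r0.
by exists (r * u), r; split=> //; field.
Qed.

(** Write w = a / s with s outside P, and let c be in P. Take z_t as in
    [gv_pair]. Then w c (s z_t) = (s w)(c z_t) is in D. Moreover s (c z_t) =
    (s z_t) c is in P, so c z_t is in P and, w being in the Kaplansky transform,
    w multiplies a power of c z_t into D. As the s z_t and c z_t form a
    Glaz-Vasconcelos family, [gv_powers] puts w c in D. *)
Lemma kaplansky_local_inv w :
  kaplansky D P w -> localization D P w -> colon D P w.
Proof.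
move=> Ow [a [s [Da Ds Ps wE]]] c Pc.
have s0 : s != 0 by apply/eqP => s0; apply: Ps; rewrite s0.
have Dsw : D (s * w) by rewrite wE mulrC divfK.
have Dc := PD Pc.
have [T [z [Dsz Dcz gv]]] := gv_pair Ds Dc s0.
have Pcz t : P (c * z t).
  have /Pprime [] // : P (s * (c * z t)).
  by rewrite mulrCA mulrC; apply: PM.
have [m Dm] := kaplansky_exponents (fun=> Ow) Pcz.
pose g (x : T + T) := match x with inl t => s * z t | inr t => c * z t end.
pose e (x : T + T) := match x with inl t => 1%N | inr t => m t end.
apply: (@gv_powers _ _ ringD _ g e) => [[] //|y Dy|[t|t]] /=.
- by apply: gv => t; [exact: (Dy (inl t))|exact: (Dy (inr t))].
- have -> : w * c * (s * z t) ^+ 1 = s * w * (c * z t) by ring.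
  exact: subringM.
- by rewrite mulrAC; exact: subringM.
Qed.

Lemma gv_of_t_invertible (I : set K) : t_invertible D I ->
  exists (T : finType) (a b : T -> K),
    [/\ forall t, I (a t), forall t x, I x -> D (x * b t),
        (exists t, a t * b t != 0) & gv_family D (fun t => a t * b t)].
Proof.
move=> inv; have := subring1 ringD; rewrite -{1}inv.
move=> /(gv_of_t_closure ringD) [T [a [b [Ia Ib ab0 gv]]]].
by exists T, a, b; split=> // t x Ix; rewrite mulrC; exact: Ib.
Qed.

(** If u P^n is in D with u outside the localization, the ideal I of
    denominators of u satisfies P^n <= I <= P. For w in the Kaplansky transform,
    [gv_absorb] gives w I^N inside D for some N, hence w P^(n N) inside D. *)
Lemma kaplansky_sub_nagata :
  ~ (nagata D P `<=` localization D P) -> kaplansky D P `<=` nagata D P.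
Proof.
move=> /existsNP [u /not_implyP [[n /= n_gt0]]].
rewrite colon_pow_exp // => Pu locu w Ow.
have [_ _ inv] := t_invertible_denominators u.
have [T [a [b [Ia Ib _ gv]]]] := gv_of_t_invertible inv.
have IP := denominators_sub locu.
have PI : colon_pow (denominators D u) P n 1.
  have I_of c k : D c -> colon_pow D P k (u * c) ->
      colon_pow (denominators D u) P k c.
    elim: k c => [|k IHk] c Dc Puc; first by split; rewrite // mulrC.
    move=> x Px; apply: IHk; first by apply: subringM => //; exact: PD.
    by rewrite mulrA; exact: Puc.
  by apply: I_of; rewrite ?mulr1 //; exact: subring1.
have [m Dm] := kaplansky_exponents (fun=> Ow) (fun t => IP _ (Ia t)).
have ID : denominators D u `<=` D by move=> r [].
(* The successor keeps the exponent of P positive. *)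
have := gv_absorb ringD ID Ia Ib gv (leqW (leqnn (\sum_t m t))) Dm.
move=> /(colon_pow_comp PI) wP; exists (n * (\sum_t m t).+1)%N => /=.
  by rewrite muln_gt0 n_gt0.
by rewrite colon_pow_exp // muln_gt0 n_gt0.
Qed.

Lemma radical_of_kaplansky u :
  kaplansky D P u -> ~ localization D P u -> P = radical D (denominators D u).
Proof.
move=> Ou locu; apply/seteqP.
split=> [a Pa|a [Da [n _ /(denominators_sub locu)]]].
  split; first exact: PD.
  have [n n_gt0 Du] := Ou a Pa; exists n => //; split.
    by apply: subringX => //; exact: PD.
  by rewrite mulrC.
exact: PX.
Qed.

(** Let O be the Kaplansky transform, and a_t, b_t the factors given by the
    t-invertibility of I. If y multiplies all a_t into O and c is in P, choose n
    with c^n in I and exponents with y a_t c^(m_t) in D. Then y c^N (a_t b_t) is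
    in D for N the sum of n and of all m_t, since c^n b_t is in D; hence y c^N is
    in D and y is in O. So the ideal of O generated by the a_t, which lies in
    P O, has inverse O. *)
Lemma t_closure_of_radical (I : set K) :
  ideal D I -> t_invertible D I -> P = radical D I ->
  t_closure (kaplansky D P) (ideal_mul P (kaplansky D P)) = kaplansky D P.
Proof.
move=> [_ ID] inv PE.
have [T [a [b [Ia Ib [t0 ab0] gv]]]] := gv_of_t_invertible inv.
have IP : I `<=` P.
  by move=> x Ix; rewrite PE; split; [exact: ID|exists 1%N].
have PO := sub_kaplansky ringD PD.
apply/seteqP; split.
  apply: t_closure_sub => // _ [n [x [y [Px Oy ->]]]].
  apply: (subring_sum ringO) => // i; apply: (subringM ringO) => //.
  exact/PO/PD.
move=> w Ow; pose g (i : 'I_#|T|) := a (enum_val i).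
exists (Defs.span (kaplansky D P) g).
  split; first by exists #|T|, g.
    exists (g (enum_rank t0)); first exact: span_gen.
    by rewrite /g enum_rankK; apply: contraNneq ab0 => ->; rewrite mul0r.
  move=> _ [c Oc ->]; exists #|T|, g, c; split=> //.
    by move=> i; exact/IP/Ia.
  by apply: eq_bigr => i _; rewrite mulrC.
move=> y Jy; apply: (subringM ringO) => // c Pc.
have [Dc [n n_gt0 Icn]] : radical D I c by rewrite -PE.
have ya t : kaplansky D P (y * a t).
  by rewrite -(enum_rankK t); apply: Jy; exact: span_gen.
have [m Dm] := kaplansky_exponents ya (fun=> Pc).
exists (\sum_t m t + n)%N; first by rewrite addn_gt0 n_gt0 orbT.
apply: gv => t; rewrite (bigD1 t) //=.
have -> : y * c ^+ (m t + \sum_(i | i != t) m i + n) * (a t * b t) =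
  y * a t * c ^+ m t * c ^+ (\sum_(i | i != t) m i) * (c ^+ n * b t).
  by rewrite !exprD; ring.
apply: subringM => //; last exact: Ib.
by apply: subringM => //; exact: subringX.
Qed.

(** The t-closure over the Kaplansky transform O is witnessed by products a_t b_t
    with a_t in P and b_t in O, so the ideal A of D spanned by the a_t has
    A^-1 inside O. If O were inside the localization, then for x in A and y in
    A^-1, the product x y would be in D and in P D_P, hence in P; so the
    t-closure of A A^-1, which is D, would be inside the t-ideal P. *)
Lemma kaplansky_nonlocal :
  t_closure (kaplansky D P) (ideal_mul P (kaplansky D P)) = kaplansky D P ->
  ~ (kaplansky D P `<=` localization D P).
Proof.
move=> tO locO.
have := subring1 ringO; rewrite -{1}tO.
move=> /(gv_of_t_closure ringO) [T [a [b [Pa Ob [t0 ab0] gv]]]].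
pose g (i : 'I_#|T|) := a (enum_val i).
have Dg i : D (g i) by exact/PD/Pa.
have gt0 : g (enum_rank t0) != 0.
  by rewrite /g enum_rankK; apply: contraNneq ab0 => ->; rewrite mul0r.
have inv := t_invertible_span Dg gt0.
have AO : ideal_inv D (Defs.span D g) `<=` kaplansky D P.
  move=> y Ay; apply: gv => t; rewrite mulrA; apply: (subringM ringO) => //.
  apply/(sub_kaplansky ringD PD); rewrite -(enum_rankK t); apply: Ay.
  exact: span_gen.
have PE : P = t_closure D P by case: tprimeP => _ [].
apply: P1; rewrite PE.
apply: (@t_closureS _ D
  (ideal_mul (Defs.span D g) (ideal_inv D (Defs.span D g)))); last first.
  by rewrite inv; exact: subring1.
have Padd x y : P x -> P y -> P (x + y).
  by case: tprimeP => -[[[_ + _] _] _ _] _; apply.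
have AP : Defs.span D g `<=` P.
  by move=> _ [c Dc ->]; apply: big_ind => // i _; apply: PM => //; exact: Pa.
move=> _ [n [x [y [Ax Ay ->]]]]; apply: big_ind => // i _.
have Dxy : D (x i * y i) by rewrite mulrC; exact: Ay.
have [r [s [Dr Ds Ps yE]]] := locO _ (AO _ (Ay i)).
have s0 : s != 0 by apply/eqP => s0; apply: Ps; rewrite s0.
have /(Pprime Dxy Ds) [] // : P (x i * y i * s).
by rewrite yE -mulrA divfK // mulrC; apply: PM => //; exact: AP.
Qed.

End PVMD.

Theorem theorem3p6 (K : fieldType) (R P : set K)
    (pvmdR : PVMD R) (tprimeP : t_prime_ideal R P) :
  (nagata R P `<` kaplansky R P <->
     nagata R P = localization R P `&` kaplansky R P /\
     ~ (kaplansky R P `<=` localization R P)) /\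
  ((t_closure (kaplansky R P) (ideal_mul P (kaplansky R P)) = kaplansky R P <->
      ~ (kaplansky R P `<=` localization R P)) /\
   (~ (kaplansky R P `<=` localization R P) <->
      exists I : set K,
        [/\ ideal R I, nonzero I, t_invertible R I & P = radical R I])).
Proof.
have ringR : subring_closed [in R] by case: pvmdR => -[].
have TO : nagata R P `<=` kaplansky R P by exact: nagata_sub_kaplansky.
have OT : localization R P `&` kaplansky R P `<=` nagata R P.
  move=> w [locw Ow]; exists 1%N => //.
  exact: (kaplansky_local_inv pvmdR tprimeP Ow locw).
have rad : ~ (kaplansky R P `<=` localization R P) -> exists I : set K,
    [/\ ideal R I, nonzero I, t_invertible R I & P = radical R I].
  move=> /existsNP [u /not_implyP [Ou locu]]; exists (denominators R u).
  have [Iu I0 inv] := t_invertible_denominators pvmdR u.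
  by split=> //; exact: radical_of_kaplansky.
have rad_t I : ideal R I -> t_invertible R I -> P = radical R I ->
    t_closure (kaplansky R P) (ideal_mul P (kaplansky R P)) = kaplansky R P.
  exact: t_closure_of_radical.
have t_loc := kaplansky_nonlocal pvmdR tprimeP.
split; last split; last 1 first.
- by split=> // -[I [idI _ inv PE]]; apply/t_loc/(rad_t I).
- split=> [[_ nOT]|[TE nOloc]]; last first.
    by split=> // OsubT; apply: nOloc => w /OsubT; rewrite TE => -[].
  split; last first.
    move=> Oloc; apply: nOT => w Ow; apply: OT.
    by split=> //; exact: Oloc.
  apply/seteqP; split=> // w Tw; split; last exact: TO.
  apply: contrapT => locw; apply: nOT; apply: kaplansky_sub_nagata => //.
  by move=> /(_ w Tw).
- split=> // /rad [I [idI _ inv PE]]; exact: (rad_t I).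
Qed.
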